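(* Let $\mathcal{M}'_a: z(u,v)=f(u)\,l(v)+g(u)\,e_4$, $u\in I$, $v\in J$, be a meridian surface of type $\mathcal{M}'_a$ in $\mathbb{E}^4_2$ (so $l$ is a unit-speed spacelike curve on $\mathbb{S}^2_1(1)$ and $f'^2-g'^2=-1$). Then $\mathcal{M}'_a$ has non-zero constant mean curvature, i.e. $\langle H,H\rangle=c=\mathrm{const}$, $c\neq0$, if and only if the curve $l$ has constant curvature $\kappa=a=\mathrm{const}$, $a\neq0$, and the meridian curve $u\mapsto(f(u),g(u))$ is determined by $f'=\varphi(f)$, where $$\varphi(t)=\pm\frac1t\sqrt{\left(b\pm\frac t2\sqrt{a^2+4ct^2}\pm\frac{a^2}{4\sqrt c}\ln\left|2\sqrt c\,t+\sqrt{a^2+4ct^2}\right|\right)^2-t^2}\quad\text{if } c>0,$$ $$\varphi(t)=\pm\frac1t\sqrt{\left(b\pm\frac t2\sqrt{a^2+4ct^2}\pm\frac{a^2}{4\sqrt{-c}}\arcsin\frac{2\sqrt{-c}\,t}{a}\right)^2-t^2}\quad\text{if } c<0,$$ $b=\mathrm{const}$, and $g(u)$ is defined by $g'=\sqrt{f'^2+1}$.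
   Context: $\mathbb{E}^4_2$ is $\mathbb{R}^4$ with the inner product $\langle x,y\rangle=x_1y_1+x_2y_2-x_3y_3-x_4y_4$ and standard basis $e_1,e_2,e_3,e_4$. Let $\mathbb{E}^3_1=\mathrm{span}\{e_1,e_2,e_3\}$ and $\mathbb{S}^2_1(1)=\{V\in\mathbb{E}^3_1:\langle V,V\rangle=1\}$. Meridian surface of type $\mathcal{M}'_a$: let $I,J\subset\mathbb{R}$ be intervals, $f,g:I\to\mathbb{R}$ smooth with $f$ nowhere zero, $f'^2-g'^2=-1$ and $g'>0$; let $l:J\to\mathbb{S}^2_1(1)$ be a smooth curve with $\langle l',l'\rangle=1$. The surface is $z(u,v)=f(u)l(v)+g(u)e_4$. Its induced metric is Lorentzian, with orthonormal tangent frame $X=z_u$, $Y=z_v/f=l'$, $\langle X,X\rangle=-1$, $\langle Y,Y\rangle=1$. Curvature of $l$ (spherical curvature): put $t=l'$ and let $n$ be the vector field along $l$ (unique up to sign) such that $\{l,t,n\}$ is an orthonormal frame of $\mathbb{E}^3_1$ with $\langle n,n\rangle=-1$; then $\kappa(v)=\langle t'(v),n(v)\rangle$, so that $t'=-\kappa n-l$, $n'=-\kappa t$. For a Lorentz surface with second fundamental form $h$, the mean curvature vector field is $H=\tfrac12\,\mathrm{tr}\,h=\tfrac12\left(h(E_1,E_1)-h(E_2,E_2)\right)$ for any local orthonormal tangent frame with $\langle E_1,E_1\rangle=1$, $\langle E_2,E_2\rangle=-1$. ''$f'=\varphi(f)$'' means $f'(u)=\varphi(f(u))$.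
   Formalization: Proved for f not constant and κ not identically zero; the two signs inside the bracket of φ are tied (equal; opposite if c<0 and a<0), the outer sign may change where f'=0, and b and the bracket signs are constant on each interval where a²+4cf²>0. *)

(* Defs.v *)
From Stdlib Require Import Reals.
From Coquelicot Require Import Coquelicot.
Open Scope R_scope.

Definition E4 : Type := (R * R * R * R)%type.

Definition x1 (x : E4) : R := fst (fst (fst x)).
Definition x2 (x : E4) : R := snd (fst (fst x)).
Definition x3 (x : E4) : R := snd (fst x).
Definition x4 (x : E4) : R := snd x.

Definition e4 : E4 := (0, 0, 0, 1).

(* The neutral inner product of E^4_2. *)
Definition inner (x y : E4) : R :=
  x1 x * x1 y + x2 x * x2 y - x3 x * x3 y - x4 x * x4 y.

(* E^3_1 = span {e1, e2, e3}. *)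
Definition in_E31 (x : E4) : Prop := x4 x = 0.

(* The unit sphere S^2_1(1) of E^3_1. *)
Definition in_S21 (x : E4) : Prop := in_E31 x /\ inner x x = 1.

(* Nonempty open intervals, bounded or not. *)
Definition open_interval (K : R -> Prop) : Prop :=
  open K /\ (exists x, K x) /\
  (forall x y w, K x -> K y -> x <= w <= y -> K w).

Definition smooth_on (K : R -> Prop) (f : R -> R) : Prop :=
  forall (k : nat) (x : R), K x -> ex_derive_n f k x.

Definition smooth4_on (K : R -> Prop) (w : R -> E4) : Prop :=
  smooth_on K (fun s => x1 (w s)) /\ smooth_on K (fun s => x2 (w s)) /\
  smooth_on K (fun s => x3 (w s)) /\ smooth_on K (fun s => x4 (w s)).

Definition Derive4 (w : R -> E4) (s : R) : E4 :=
  (Derive (fun r => x1 (w r)) s, Derive (fun r => x2 (w r)) s,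
   Derive (fun r => x3 (w r)) s, Derive (fun r => x4 (w r)) s).

Definition Du (z : R -> R -> E4) (u v : R) : E4 := Derive4 (fun s => z s v) u.
Definition Dv (z : R -> R -> E4) (u v : R) : E4 := Derive4 (fun s => z u s) v.

(* A tangent vector at z (u, v) is given by its coordinates (p, q) in the
   basis z_u, z_v. *)
Definition tangent (z : R -> R -> E4) (u v : R) (X : R * R) : E4 :=
  plus (scal (fst X) (Du z u v)) (scal (snd X) (Dv z u v)).

Definition orthonormal_frame (z : R -> R -> E4) (u v : R) (E1 E2 : R * R)
    : Prop :=
  inner (tangent z u v E1) (tangent z u v E1) = 1 /\
  inner (tangent z u v E2) (tangent z u v E2) = -1 /\
  inner (tangent z u v E1) (tangent z u v E2) = 0.

(* Component of w orthogonal to the tangent plane spanned by an orthonormal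
   frame E1, E2 with <E1,E1> = 1, <E2,E2> = -1. *)
Definition normal_part (z : R -> R -> E4) (u v : R) (E1 E2 : R * R) (w : E4)
    : E4 :=
  let T1 := tangent z u v E1 in
  let T2 := tangent z u v E2 in
  plus (minus w (scal (inner w T1) T1)) (scal (inner w T2) T2).

(* D_X Y at (u, v) for X, Y with constant coordinates. Any other extension of
   Y changes it by a tangent vector, so h (X, Y) below is the normal part of
   D_X Y for every extension. *)
Definition flat_derivative (z : R -> R -> E4) (u v : R) (X Y : R * R) : E4 :=
  plus (plus (scal (fst X * fst Y) (Du (Du z) u v))
             (scal (fst X * snd Y + snd X * fst Y) (Du (Dv z) u v)))
       (scal (snd X * snd Y) (Dv (Dv z) u v)).

(* Second fundamental form h (X, Y); the frame E1, E2 only serves to take the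
   normal part. *)
Definition sff (z : R -> R -> E4) (u v : R) (E1 E2 X Y : R * R) : E4 :=
  normal_part z u v E1 E2 (flat_derivative z u v X Y).

Definition mean_curvature_vector (z : R -> R -> E4) (u v : R) (E1 E2 : R * R)
    : E4 :=
  scal (1 / 2) (minus (sff z u v E1 E2 E1 E1) (sff z u v E1 E2 E2 E2)).

(* <H, H> = c on I x J, H being computed in any orthonormal frame. *)
Definition constant_mean_curvature (I J : R -> Prop) (z : R -> R -> E4)
    (c : R) : Prop :=
  forall u v, I u -> J v -> forall E1 E2, orthonormal_frame z u v E1 E2 ->
    inner (mean_curvature_vector z u v E1 E2)
          (mean_curvature_vector z u v E1 E2) = c.

Definition meridian_surface (f g : R -> R) (l : R -> E4) (u v : R) : E4 :=
  plus (scal (f u) (l v)) (scal (g u) e4).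

(* The data of a meridian surface of type M'_a. *)
Record meridian_Ma' (I J : R -> Prop) (f g : R -> R) (l : R -> E4) : Prop := {
  Ma_I : open_interval I;
  Ma_J : open_interval J;
  Ma_f : smooth_on I f;
  Ma_g : smooth_on I g;
  Ma_l : smooth4_on J l;
  Ma_f_neq0 : forall u, I u -> f u <> 0;
  Ma_meridian : forall u, I u -> Derive f u ^ 2 - Derive g u ^ 2 = -1;
  Ma_g_incr : forall u, I u -> 0 < Derive g u;
  Ma_sphere : forall v, J v -> in_S21 (l v);
  Ma_unit : forall v, J v -> inner (Derive4 l v) (Derive4 l v) = 1
}.

(* n is one of the two smooth fields along l for which l, t = l', n is an
   orthonormal frame of E^3_1. *)
Record spherical_normal (J : R -> Prop) (l n : R -> E4) : Prop := {
  sn_smooth : smooth4_on J n;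
  sn_E31 : forall v, J v -> in_E31 (n v);
  sn_unit : forall v, J v -> inner (n v) (n v) = -1;
  sn_l : forall v, J v -> inner (n v) (l v) = 0;
  sn_t : forall v, J v -> inner (n v) (Derive4 l v) = 0
}.

Definition kappa (l n : R -> E4) (v : R) : R :=
  inner (Derive4 (Derive4 l) v) (n v).

Definition is_sign (s : R) : Prop := s = 1 \/ s = -1.

(* The inner bracket of phi; s2 and s3 are its two signs. *)
Definition bracket (c a b s2 s3 t : R) : R :=
  if Rlt_dec 0 c then
    b + s2 * (t / 2 * sqrt (a ^ 2 + 4 * c * t ^ 2))
      + s3 * (a ^ 2 / (4 * sqrt c)
              * ln (Rabs (2 * sqrt c * t + sqrt (a ^ 2 + 4 * c * t ^ 2))))
  else
    b + s2 * (t / 2 * sqrt (a ^ 2 + 4 * c * t ^ 2))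
      + s3 * (a ^ 2 / (4 * sqrt (- c)) * asin (2 * sqrt (- c) * t / a)).

Definition phi (c a b s1 s2 s3 t : R) : R :=
  s1 * (1 / t) * sqrt (bracket c a b s2 s3 t ^ 2 - t ^ 2).

(* The domain of phi: both radicands are nonnegative. For c < 0 the first
   condition also puts the argument of asin in [-1, 1]. *)
Definition phi_dom (c a b s2 s3 t : R) : Prop :=
  t <> 0 /\ 0 <= a ^ 2 + 4 * c * t ^ 2 /\
  0 <= bracket c a b s2 s3 t ^ 2 - t ^ 2.

(* The two signs in the bracket are not independent: they are tied so that
   the bracket is a primitive of +sqrt (a^2 + 4 c t^2) or of its opposite.
   The signs agree, except that for c < 0 and a < 0 the odd function asin of
   (2 sqrt (-c) t / a) already carries the sign of a. *)
Definition tied_signs (c a s2 s3 : R) : Prop :=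
  is_sign s2 /\ is_sign s3 /\
  (0 < c -> s3 = s2) /\
  (c < 0 -> 0 < a -> s3 = s2) /\
  (c < 0 -> a < 0 -> s3 = - s2).

(* f' = phi (f) on K, for the given b, s2, s3. The outer sign is the sign of
   f f', so it is constant wherever f' does not vanish and changes where f'
   does. *)
Definition solves_phi (K : R -> Prop) (f : R -> R) (c a b s2 s3 : R) : Prop :=
  forall u, K u ->
    phi_dom c a b s2 s3 (f u) /\
    exists s1, is_sign s1 /\ Derive f u = phi c a b s1 s2 s3 (f u).

(* The meridian is determined by f' = phi (f). The constant b and the signs
   in the bracket are fixed on each interval on which a^2 + 4 c f^2 > 0, hence
   on the whole of I if c > 0, or if c < 0 and f' has no zero (at a zero of
   a^2 + 4 c f^2 the function f^2 is maximal, so f' = 0). At such a zero the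
   root sqrt (a^2 + 4 c f^2) changes branch along a smooth solution, and
   the sign and the constant b change with it. *)
Definition determined_by_phi (I : R -> Prop) (f : R -> R) (c a : R) : Prop :=
  (forall u, I u -> 0 <= a ^ 2 + 4 * c * f u ^ 2) /\
  (forall K : R -> Prop, open_interval K -> (forall u, K u -> I u) ->
    (forall u, K u -> 0 < a ^ 2 + 4 * c * f u ^ 2) ->
    exists b s2 s3 : R, tied_signs c a s2 s3 /\ solves_phi K f c a b s2 s3).

(* Main.v *)
(* Differentiating the frame {l, t, n} gives
     4 f^2 (f'^2 + 1) <H,H> = (f f'' + f'^2 + 1)^2 - kappa^2 (f'^2 + 1),
   so <H,H> = c forces kappa^2, hence kappa, to be a constant a, and becomes
   the equation (f f'' + f'^2 + 1)^2 = (f'^2 + 1) (a^2 + 4 c f^2).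
   With E = (f f'' + f'^2 + 1) / g' this reads E^2 = a^2 + 4 c f^2, while
   (f g')' = f' E. Where the right-hand side is positive, E / sqrt (...) is a
   constant sign, so f g' - B(f) is constant for a primitive B of
   +- sqrt (a^2 + 4 c t^2); absorbing the constant in B, the identity
   f^2 (f'^2 + 1) = B(f)^2 is f' = phi (f).
   Conversely, differentiating that identity yields the second-order equation
   at every point where f' does not vanish, and smoothness of f propagates it
   to the whole interval. *)
Require Import Defs.
From Stdlib Require Import Reals Lra Lia.
From Coquelicot Require Import Coquelicot.
Open Scope R_scope.

(** * Frames in E^4_2 and E^3_1 *)

Lemma inner_sym (x y : E4) : inner x y = inner y x.
Proof. unfold inner; ring. Qed.

Lemma inner_plus_l (x y w : E4) :
  inner (plus x y) w = inner x w + inner y w.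
Proof.
  destruct x as [[[? ?] ?] ?], y as [[[? ?] ?] ?].
  unfold inner, x1, x2, x3, x4, plus; simpl; unfold plus; simpl; ring.
Qed.

Lemma inner_scal_l (k : R) (x w : E4) : inner (scal k x) w = k * inner x w.
Proof.
  destruct x as [[[? ?] ?] ?].
  unfold inner, x1, x2, x3, x4, scal; simpl; unfold scal; simpl;
    unfold mult; simpl; ring.
Qed.

Lemma inner_minus_l (x y w : E4) :
  inner (minus x y) w = inner x w - inner y w.
Proof.
  destruct x as [[[? ?] ?] ?], y as [[[? ?] ?] ?].
  unfold inner, x1, x2, x3, x4, minus, plus, opp; simpl;
    unfold plus, opp; simpl; ring.
Qed.

Lemma inner_plus_r (x y w : E4) :
  inner w (plus x y) = inner w x + inner w y.
Proof. rewrite !(inner_sym w); apply inner_plus_l. Qed.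

Lemma inner_scal_r (k : R) (x w : E4) : inner w (scal k x) = k * inner w x.
Proof. rewrite !(inner_sym w); apply inner_scal_l. Qed.

Lemma inner_minus_r (x y w : E4) :
  inner w (minus x y) = inner w x - inner w y.
Proof. rewrite !(inner_sym w); apply inner_minus_l. Qed.

Ltac expand_inner :=
  repeat (rewrite inner_plus_l || rewrite inner_minus_l
          || rewrite inner_scal_l || rewrite inner_plus_r
          || rewrite inner_minus_r || rewrite inner_scal_r).

(** If the rows of a 2 x 2 matrix are orthonormal for a Lorentz form, so are its columns:
    [A eta A^T = eta] implies [A^T eta A = eta]. This is what makes the trace of [h] independent of
    the frame. *)
Lemma lorentz_frame_dual (p q r s : R) :
  q ^ 2 - p ^ 2 = 1 -> s ^ 2 - r ^ 2 = -1 -> q * s = p * r ->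
  p ^ 2 - r ^ 2 = -1 /\ q ^ 2 - s ^ 2 = 1 /\ p * q - r * s = 0.
Proof.
  intros H1 H2 H3.
  assert (H4 : (q * s) ^ 2 = (p * r) ^ 2) by now rewrite H3.
  assert (Hr : r ^ 2 = 1 + p ^ 2).
  { replace ((q * s) ^ 2) with (q ^ 2 * s ^ 2) in H4 by ring.
    replace (q ^ 2) with (1 + p ^ 2) in H4 by lra.
    replace (s ^ 2) with (r ^ 2 - 1) in H4 by lra.
    lra. }
  repeat split; try lra.
  assert (Hr0 : r <> 0).
  { intros ->. pose proof (pow2_ge_0 p). lra. }
  apply Rmult_eq_reg_l with r; [|exact Hr0].
  replace (r * (p * q - r * s)) with (q * (p * r) - r ^ 2 * s) by ring.
  rewrite <- H3. replace (r ^ 2) with (q ^ 2) by lra. ring.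
Qed.

(** The trace of the second derivatives is the same in every orthonormal frame, so it can be read
    off in the frame [z_u], [z_v / F], where it is [W]. The right-hand side is [<W,W>] less the
    contribution of the tangential part of [W]. *)
Lemma mean_curvature_frame (z : R -> R -> E4) (u v F : R) (E1 E2 : R * R) :
  F <> 0 ->
  inner (Du z u v) (Du z u v) = -1 ->
  inner (Du z u v) (Dv z u v) = 0 ->
  inner (Dv z u v) (Dv z u v) = F ^ 2 ->
  orthonormal_frame z u v E1 E2 ->
  let H := mean_curvature_vector z u v E1 E2 in
  let W := minus (scal (/ F ^ 2) (Dv (Dv z) u v)) (Du (Du z) u v) in
  4 * inner H H =
    inner W W + inner W (Du z u v) ^ 2 - inner W (Dv z u v) ^ 2 / F ^ 2.
Proof.
  intros HF Huu Huv Hvv [H1 [H2 H3]] H W.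
  destruct E1 as [p q], E2 as [r s].
  unfold H, mean_curvature_vector, sff, normal_part in *.
  set (T1 := tangent z u v (p, q)) in *.
  set (T2 := tangent z u v (r, s)) in *.
  (* [(p, F q)] and [(r, F s)] are the coordinates of the frame in the orthonormal basis [z_u],
     [z_v / F]. *)
  assert (HD : p ^ 2 - r ^ 2 = -1 /\ (F * q) ^ 2 - (F * s) ^ 2 = 1
               /\ p * (F * q) - r * (F * s) = 0).
  { revert H1 H2 H3; unfold T1, T2, tangent; simpl fst; simpl snd.
    expand_inner. rewrite (inner_sym (Dv z u v) (Du z u v)), Huu, Huv, Hvv.
    intros. apply lorentz_frame_dual; nra. }
  destruct HD as [D1 [D2 D3]].
  assert (D2' : q ^ 2 - s ^ 2 = / F ^ 2).
  { apply Rmult_eq_reg_l with (F ^ 2); [|now apply pow_nonzero].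
    rewrite Rinv_r by now apply pow_nonzero. lra. }
  assert (D3' : p * q - r * s = 0).
  { apply Rmult_eq_reg_l with F; [lra|exact HF]. }
  assert (HW : minus (flat_derivative z u v (p, q) (p, q))
                     (flat_derivative z u v (r, s) (r, s)) = W).
  { unfold W, flat_derivative; rewrite <- D2'; simpl fst; simpl snd.
    destruct (Du (Du z) u v) as [[[a1 a2] a3] a4],
      (Dv (Dv z) u v) as [[[b1 b2] b3] b4],
      (Du (Dv z) u v) as [[[c1 c2] c3] c4].
    (* Componentwise, the mixed derivative [c] carries the coefficient [2 (p q - r s) = 0], and [a]
       the coefficient -1. *)
    assert (Hc : forall a b c : R,
      p * p * a + (p * q + q * p) * c + q * q * b
        + - (r * r * a + (r * s + s * r) * c + s * s * b)
      = (q ^ 2 - s ^ 2) * b + - a).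
    { intros. transitivity ((p ^ 2 - r ^ 2) * a + 2 * (p * q - r * s) * c
        + (q ^ 2 - s ^ 2) * b); [ring|]. rewrite D1, D3'. ring. }
    exact (f_equal2 pair (f_equal2 pair (f_equal2 pair (Hc a1 b1 c1)
             (Hc a2 b2 c2)) (Hc a3 b3 c3)) (Hc a4 b4 c4)). }
  rewrite <- HW.
  set (w1 := flat_derivative z u v (p, q) (p, q)) in *.
  set (w2 := flat_derivative z u v (r, s) (r, s)) in *.
  (* Pythagoras: the normal part is linear, and its square is the full square minus the signed
     squares of the two tangential components. *)
  transitivity (inner (minus w1 w2) (minus w1 w2)
    - inner (minus w1 w2) T1 ^ 2 + inner (minus w1 w2) T2 ^ 2).
  - expand_inner.
    rewrite ?(inner_sym w2 w1), ?(inner_sym T1 w1), ?(inner_sym T1 w2),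
      ?(inner_sym T2 w1), ?(inner_sym T2 w2), ?(inner_sym T2 T1), ?H1, ?H2, ?H3.
    field.
  - set (w := minus w1 w2).
    unfold T1, T2, tangent; simpl fst; simpl snd. expand_inner.
    unfold Rdiv; rewrite <- D2'.
    set (A := inner w (Du z u v)); set (B := inner w (Dv z u v)).
    replace (inner w w - (p * A + q * B) ^ 2 + (r * A + s * B) ^ 2) with
      (inner w w - (p ^ 2 - r ^ 2) * A ^ 2 - 2 * (p * q - r * s) * A * B
       - B ^ 2 * (q ^ 2 - s ^ 2)) by ring.
    rewrite D1, D3'. ring.
Qed.

(** Such a triple is a basis of [E^3_1], so the only vector orthogonal to all three members is 0. *)
Lemma E31_orthogonal_eq0 (a b d w : E4) :
  in_E31 a -> in_E31 b -> in_E31 d -> in_E31 w ->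
  inner a a = 1 -> inner b b = 1 -> inner d d = -1 ->
  inner a b = 0 -> inner a d = 0 -> inner b d = 0 ->
  inner w a = 0 -> inner w b = 0 -> inner w d = 0 ->
  inner w w = 0.
Proof.
  destruct a as [[[a1 a2] a3] a4], b as [[[b1 b2] b3] b4],
    d as [[[d1 d2] d3] d4], w as [[[w1 w2] w3] w4].
  unfold in_E31, inner, x1, x2, x3, x4; simpl.
  intros -> -> -> -> Haa Hbb Hdd Hab Had Hbd Hwa Hwb Hwd.
  set (D := a1 * (b2 * d3 - b3 * d2) - a2 * (b1 * d3 - b3 * d1)
            + a3 * (b1 * d2 - b2 * d1)).
  set (ab := a1 * b1 + a2 * b2 - a3 * b3 - 0 * 0) in *.
  set (ad := a1 * d1 + a2 * d2 - a3 * d3 - 0 * 0) in *.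
  set (bd := b1 * d1 + b2 * d2 - b3 * d3 - 0 * 0) in *.
  set (aa := a1 * a1 + a2 * a2 - a3 * a3 - 0 * 0) in *.
  set (bb := b1 * b1 + b2 * b2 - b3 * b3 - 0 * 0) in *.
  set (dd := d1 * d1 + d2 * d2 - d3 * d3 - 0 * 0) in *.
  set (wa := w1 * a1 + w2 * a2 - w3 * a3 - 0 * 0) in *.
  set (wb := w1 * b1 + w2 * b2 - w3 * b3 - 0 * 0) in *.
  set (wd := w1 * d1 + w2 * d2 - w3 * d3 - 0 * 0) in *.
  (* The Gram determinant of a, b, d is - D^2. *)
  assert (HD : D * D = 1).
  { transitivity (- (aa * (bb * dd - bd * bd) - ab * (ab * dd - bd * ad)
                     + ad * (ab * bd - bb * ad))).
    - unfold D, aa, bb, dd, ab, ad, bd; ring.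
    - rewrite Haa, Hbb, Hdd, Hab, Had, Hbd; ring. }
  assert (HD0 : D <> 0) by (intros E; rewrite E in HD; lra).
  (* Cramer's rule for the linear system formed by the three orthogonality relations. *)
  assert (W1 : D * w1 = 0).
  { transitivity (wa * (b2 * d3 - b3 * d2) - wb * (a2 * d3 - a3 * d2)
                  + wd * (a2 * b3 - a3 * b2)).
    - unfold D, wa, wb, wd; ring.
    - rewrite Hwa, Hwb, Hwd; ring. }
  assert (W2 : D * w2 = 0).
  { transitivity (- (wa * (b1 * d3 - b3 * d1) - wb * (a1 * d3 - a3 * d1)
                  + wd * (a1 * b3 - a3 * b1))).
    - unfold D, wa, wb, wd; ring.
    - rewrite Hwa, Hwb, Hwd; ring. }
  assert (W3 : D * w3 = 0).
  { transitivity (- (wa * (b1 * d2 - b2 * d1) - wb * (a1 * d2 - a2 * d1)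
                  + wd * (a1 * b2 - a2 * b1))).
    - unfold D, wa, wb, wd; ring.
    - rewrite Hwa, Hwb, Hwd; ring. }
  apply Rmult_integral in W1, W2, W3.
  destruct W1 as [W1|W1], W2 as [W2|W2], W3 as [W3|W3]; try contradiction.
  rewrite W1, W2, W3; ring.
Qed.

(** The remainder [r] of [w] after projection on the frame is orthogonal to the frame, hence
    [<r,r> = 0]; expanding this gives the formula. The signs at [d] come from [<d,d> = -1]. *)
Lemma E31_orthonormal_expansion (a b d w : E4) :
  in_E31 a -> in_E31 b -> in_E31 d -> in_E31 w ->
  inner a a = 1 -> inner b b = 1 -> inner d d = -1 ->
  inner a b = 0 -> inner a d = 0 -> inner b d = 0 ->
  inner w w = inner w a ^ 2 + inner w b ^ 2 - inner w d ^ 2.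
Proof.
  intros Ha Hb Hd Hw Haa Hbb Hdd Hab Had Hbd.
  set (r := plus (minus (minus w (scal (inner w a) a)) (scal (inner w b) b))
                 (scal (inner w d) d)).
  assert (Hr : in_E31 r).
  { unfold in_E31 in *.
    change (x4 w + - (inner w a * x4 a) + - (inner w b * x4 b)
            + inner w d * x4 d = 0).
    rewrite Ha, Hb, Hd, Hw; ring. }
  assert (R0 : inner r r = 0).
  { apply (E31_orthogonal_eq0 a b d); auto; unfold r; expand_inner;
      rewrite ?(inner_sym b a), ?(inner_sym d a), ?(inner_sym d b),
        ?Haa, ?Hbb, ?Hdd, ?Hab, ?Had, ?Hbd; ring. }
  revert R0; unfold r; expand_inner.
  rewrite ?(inner_sym b a), ?(inner_sym d a), ?(inner_sym d b),
        ?(inner_sym a w), ?(inner_sym b w), ?(inner_sym d w),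
        ?Haa, ?Hbb, ?Hdd, ?Hab, ?Had, ?Hbd.
  lra.
Qed.

(** * Calculus on open intervals *)

Lemma Derive_plus_const (h : R -> R) (k x : R) :
  Derive (fun s => h s + k) x = Derive h x.
Proof.
  unfold Derive; f_equal; apply Lim_ext; intros y; f_equal; ring.
Qed.

(** The device by which an identity valid on an open set is differentiated. *)
Lemma is_derive_const_on (K : R -> Prop) (h : R -> R) (k x d : R) :
  open K -> (forall y, K y -> h y = k) -> K x -> is_derive h x d -> d = 0.
Proof.
  intros HK Hh Hx Hd.
  apply is_derive_unique in Hd. rewrite <- Hd.
  rewrite <- (Derive_const k x).
  apply Derive_ext_loc.
  apply (filter_imp (F := locally x) K); [exact Hh | now apply HK].
Qed.

Lemma derive_zero_const (K : R -> Prop) (h : R -> R) :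
  Defs.open_interval K -> (forall x, K x -> is_derive h x 0) ->
  forall x y, K x -> K y -> h x = h y.
Proof.
  intros [_ [_ Hc]] Hh.
  assert (H : forall x y, x < y -> K x -> K y -> h x = h y).
  { intros x y Hxy Hx Hy. apply (eq_is_derive h x y); [|exact Hxy].
    intros s Hs. apply Hh, (Hc x y); auto. }
  intros x y Hx Hy. destruct (Rtotal_order x y) as [L | [-> | L]].
  - auto.
  - reflexivity.
  - symmetry; auto.
Qed.

Lemma is_derive_square (h : R -> R) (x d : R) :
  is_derive h x d -> is_derive (fun s => h s ^ 2) x (2 * h x * d).
Proof.
  intros Hd. evar_last; [apply is_derive_pow, Hd|]. simpl; ring.
Qed.

(** From [2 h h' = 0]: if [k <> 0] then [h] has no zero and [h' = 0]. This is how a sign is shown to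
    be constant along an interval. *)
Lemma square_const_const (K : R -> Prop) (h : R -> R) (k : R) :
  Defs.open_interval K -> (forall x, K x -> ex_derive h x) ->
  (forall x, K x -> h x ^ 2 = k) ->
  forall x y, K x -> K y -> h x = h y.
Proof.
  intros HK Hd Hk.
  destruct (Req_dec k 0) as [-> | Hk0].
  - assert (H0 : forall x, K x -> h x = 0).
    { intros x Hx. specialize (Hk x Hx). nra. }
    intros x y Hx Hy; now rewrite !H0.
  - apply (derive_zero_const K); [exact HK|].
    intros x Hx.
    assert (E : 2 * h x * Derive h x = 0).
    { apply (is_derive_const_on K (fun s => h s ^ 2) k x); auto.
      - apply HK.
      - now apply is_derive_square, Derive_correct, Hd. }
    replace 0 with (Derive h x); [now apply Derive_correct, Hd|].
    specialize (Hk x Hx).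
    assert (h x <> 0) by (intros Z; rewrite Z in Hk; lra).
    apply Rmult_eq_reg_l with (2 * h x); lra.
Qed.

Lemma smooth_on_Derive (K : R -> Prop) (f : R -> R) :
  smooth_on K f -> smooth_on K (Derive f).
Proof.
  (* At order 0 [ex_derive_n] is [True]. *)
  intros Hf [|k] x Hx; [exact I|].
  apply (ex_derive_ext (Derive_n f (S k))).
  - intros s. replace (S k) with (k + 1)%nat by lia.
    symmetry; apply (Derive_n_comp f k 1).
  - apply (Hf (S (S k)) x Hx).
Qed.

Lemma smooth_on_is_derive (K : R -> Prop) (f : R -> R) (x : R) :
  smooth_on K f -> K x -> is_derive f x (Derive f x).
Proof. intros Hf Hx; apply Derive_correct, (Hf 1%nat x Hx). Qed.

Lemma smooth4_on_Derive4 (K : R -> Prop) (w : R -> E4) :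
  smooth4_on K w -> smooth4_on K (Derive4 w).
Proof.
  intros [H1 [H2 [H3 H4]]].
  repeat split; now apply smooth_on_Derive.
Qed.

Lemma is_derive_inner (K : R -> Prop) (w y : R -> E4) (s : R) :
  smooth4_on K w -> smooth4_on K y -> K s ->
  is_derive (fun r => inner (w r) (y r)) s
    (inner (Derive4 w s) (y s) + inner (w s) (Derive4 y s)).
Proof.
  intros [W1 [W2 [W3 W4]]] [Y1 [Y2 [Y3 Y4]]] Hs.
  apply (smooth_on_is_derive K _ s) in W1, W2, W3, W4, Y1, Y2, Y3, Y4; auto.
  unfold inner.
  evar_last.
  - apply @is_derive_minus; [apply @is_derive_minus; [apply @is_derive_plus|]|];
      (apply @is_derive_mult; [eassumption | eassumption | exact Rmult_comm]).
  - unfold minus, plus, opp, mult, Derive4, x1, x2, x3, x4; simpl; ring.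
Qed.

Lemma in_E31_Derive4 (K : R -> Prop) (w : R -> E4) :
  open K -> smooth4_on K w -> (forall s, K s -> in_E31 (w s)) ->
  forall s, K s -> in_E31 (Derive4 w s).
Proof.
  intros HK [_ [_ [_ H4]]] Hw s Hs.
  apply (is_derive_const_on K (fun r => x4 (w r)) 0 s); auto.
  apply (smooth_on_is_derive K (fun r => x4 (w r)) s H4 Hs).
Qed.

(** * The mean curvature of a meridian surface *)

(** The products of [t'] with [l] and [t] come from differentiating [<l,l> = 1], [<t,t> = 1] and
    [<l,t> = 0]; expansion in the frame then gives [<t',t'>]. Together they express
    [t' = - kappa n - l]. *)
Lemma spherical_curve_frame (J : R -> Prop) (l n : R -> E4) (v : R) :
  open J -> smooth4_on J l ->
  (forall v, J v -> in_S21 (l v)) ->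
  (forall v, J v -> inner (Derive4 l v) (Derive4 l v) = 1) ->
  spherical_normal J l n -> J v ->
  let t := Derive4 l v in
  let t' := Derive4 (Derive4 l) v in
  in_E31 t' /\ inner (l v) t = 0 /\ inner t' (l v) = -1 /\ inner t' t = 0 /\
  inner t' t' = 1 - kappa l n v ^ 2.
Proof.
  intros HJ Hl HS Hu Hn Hv t t'.
  pose proof (smooth4_on_Derive4 J l Hl) as Ht.
  assert (El : forall s, J s -> in_E31 (l s)) by (intros s Hs; apply (HS s Hs)).
  pose proof (in_E31_Derive4 J l HJ Hl El) as Et.
  pose proof (in_E31_Derive4 J _ HJ Ht Et) as Et'.
  assert (Hlt : forall s, J s -> inner (l s) (Derive4 l s) = 0).
  { intros s Hs.
    assert (E := is_derive_const_on J _ 1 s _ HJ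
                   (fun r Hr => proj2 (HS r Hr)) Hs
                   (is_derive_inner J l l s Hl Hl Hs)).
    rewrite (inner_sym (Derive4 l s)) in E. lra. }
  assert (Htt' : inner t' t = 0).
  { assert (E := is_derive_const_on J _ 1 v _ HJ Hu Hv
                   (is_derive_inner J _ _ v Ht Ht Hv)).
    fold t t' in E. rewrite (inner_sym t t') in E. lra. }
  assert (Hlt' : inner t' (l v) = -1).
  { assert (E := is_derive_const_on J _ 0 v _ HJ Hlt Hv
                   (is_derive_inner J _ _ v Hl Ht Hv)).
    fold t t' in E. rewrite (inner_sym (l v) t') in E.
    unfold t in E. rewrite (Hu v Hv) in E. lra. }
  split; [now apply Et' | split; [now apply Hlt |]].
  split; [exact Hlt' | split; [exact Htt' |]].
  rewrite (E31_orthonormal_expansion (l v) t (n v) t').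
  - rewrite Hlt', Htt'. unfold kappa; fold t'. ring.
  - now apply El.
  - now apply Et.
  - now apply Hn.
  - now apply Et'.
  - apply (HS v Hv).
  - now apply Hu.
  - now apply Hn.
  - now apply Hlt.
  - rewrite inner_sym; now apply Hn.
  - rewrite inner_sym; now apply Hn.
Qed.

(** Since [x4 (l v) = 0], each component is a multiple of [f] alone or of [g] alone, so no sum rule
    is involved and the formula also applies to [Derive f], [Derive g]. *)
Lemma Du_meridian (f g : R -> R) (l : R -> E4) (u v : R) :
  in_E31 (l v) ->
  Du (meridian_surface f g l) u v
  = plus (scal (Derive f u) (l v)) (scal (Derive g u) e4).
Proof.
  intros Hl.
  assert (C : forall y, Derive (fun s => f s * y + g s * 0) u
                        = Derive f u * y + Derive g u * 0).
  { intros y. rewrite (Derive_ext _ (fun s => f s * y)) by (intros; ring).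
    rewrite Derive_scal_l. ring. }
  assert (C4 : Derive (fun s => f s * x4 (l v) + g s * 1) u
               = Derive f u * x4 (l v) + Derive g u * 1).
  { rewrite Hl, (Derive_ext _ g) by (intros; ring). ring. }
  exact (f_equal2 pair (f_equal2 pair (f_equal2 pair (C _) (C _)) (C _)) C4).
Qed.

Lemma Derive4_ext (w y : R -> E4) (s : R) :
  (forall r, w r = y r) -> Derive4 w s = Derive4 y s.
Proof.
  intros E. unfold Derive4.
  now rewrite (Derive_ext (fun r => x1 (w r)) (fun r => x1 (y r))),
    (Derive_ext (fun r => x2 (w r)) (fun r => x2 (y r))),
    (Derive_ext (fun r => x3 (w r)) (fun r => x3 (y r))),
    (Derive_ext (fun r => x4 (w r)) (fun r => x4 (y r)))
    by (intros; now rewrite E).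
Qed.

(** [z_u] is itself of meridian form, with profile [(f', g')]. *)
Lemma Du_Du_meridian (f g : R -> R) (l : R -> E4) (u v : R) :
  in_E31 (l v) ->
  Du (Du (meridian_surface f g l)) u v
  = plus (scal (Derive (Derive f) u) (l v)) (scal (Derive (Derive g) u) e4).
Proof.
  intros Hl. rewrite <- (Du_meridian (Derive f) (Derive g) l u v Hl).
  apply Derive4_ext; intros s; now apply Du_meridian.
Qed.

Lemma Dv_meridian (f g : R -> R) (l : R -> E4) (u v : R) :
  Dv (meridian_surface f g l) u v = scal (f u) (Derive4 l v).
Proof.
  assert (C : forall h k, Derive (fun s => f u * h s + k) v = f u * Derive h v).
  { intros h k. rewrite Derive_plus_const. apply Derive_scal. }
  exact (f_equal2 pair (f_equal2 pair (f_equal2 pair (C _ _) (C _ _)) (C _ _))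
           (C _ _)).
Qed.

Lemma Dv_Dv_meridian (f g : R -> R) (l : R -> E4) (u v : R) :
  Dv (Dv (meridian_surface f g l)) u v = scal (f u) (Derive4 (Derive4 l) v).
Proof.
  assert (C : forall h, Derive (fun s => f u * h s) v = f u * Derive h v).
  { intros h. apply Derive_scal. }
  transitivity (Dv (fun u' v' => scal (f u') (Derive4 l v')) u v).
  - apply Derive4_ext; intros s; apply Dv_meridian.
  - exact (f_equal2 pair (f_equal2 pair (f_equal2 pair (C _) (C _)) (C _))
             (C _)).
Qed.

Lemma inner_e4 (x : E4) : in_E31 x -> inner x e4 = 0.
Proof.
  unfold in_E31, inner; intros ->; unfold x1, x2, x3, x4, e4; simpl; ring.
Qed.

Lemma inner_e4_e4 : inner e4 e4 = -1.
Proof. unfold inner, x1, x2, x3, x4, e4; simpl; ring. Qed.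

(** Half the derivative of [f'^2 - g'^2 = -1]. *)
Lemma meridian_derive_relation (I J : R -> Prop) (f g : R -> R) (l : R -> E4) :
  meridian_Ma' I J f g l -> forall u, I u ->
  Derive f u * Derive (Derive f) u = Derive g u * Derive (Derive g) u.
Proof.
  intros hM u Hu.
  pose proof (smooth_on_is_derive I _ u
    (smooth_on_Derive I f (Ma_f _ _ _ _ _ hM)) Hu) as Hf.
  pose proof (smooth_on_is_derive I _ u
    (smooth_on_Derive I g (Ma_g _ _ _ _ _ hM)) Hu) as Hg.
  set (f1 := Derive f) in *; set (g1 := Derive g) in *.
  set (f2 := Derive f1 u) in *; set (g2 := Derive g1 u) in *.
  assert (E : 2 * f1 u * f2 - 2 * g1 u * g2 = 0).
  { apply (is_derive_const_on I (fun s => f1 s ^ 2 - g1 s ^ 2) (-1) u).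
    - apply (Ma_I _ _ _ _ _ hM).
    - apply (Ma_meridian _ _ _ _ _ hM).
    - exact Hu.
    - apply @is_derive_minus; now apply is_derive_square. }
  lra.
Qed.

Lemma meridian_first_form (I J : R -> Prop) (f g : R -> R) (l n : R -> E4)
    (u v : R) :
  meridian_Ma' I J f g l -> spherical_normal J l n -> I u -> J v ->
  let z := meridian_surface f g l in
  inner (Du z u v) (Du z u v) = -1 /\ inner (Du z u v) (Dv z u v) = 0 /\
  inner (Dv z u v) (Dv z u v) = f u ^ 2.
Proof.
  intros hM hn Hu Hv z.
  destruct hM as [_ [HJ _] _ _ Hl _ Hfg _ HS Ht].
  destruct (spherical_curve_frame J l n v HJ Hl HS Ht hn Hv)
    as [_ [Hlt _]].
  assert (El : in_E31 (l v)) by apply (HS v Hv).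
  assert (Et : in_E31 (Derive4 l v)).
  { apply (in_E31_Derive4 J l HJ Hl); [|exact Hv]. intros s Hs; apply (HS s Hs). }
  unfold z; rewrite Du_meridian, Dv_meridian by exact El.
  expand_inner.
  rewrite ?(inner_sym e4 (l v)), ?(inner_sym e4 (Derive4 l v)).
  rewrite inner_e4_e4, (inner_e4 _ El), (inner_e4 _ Et), Hlt, (Ht v Hv).
  rewrite (proj2 (HS v Hv)).
  specialize (Hfg u Hu).
  split; [lra | split; ring].
Qed.

(** The frame [z_v / f], [z_u]. Its existence keeps the quantification over frames in
    [constant_mean_curvature] from being vacuous. *)
Lemma orthonormal_frame_meridian (I J : R -> Prop) (f g : R -> R)
    (l n : R -> E4) (u v : R) :
  meridian_Ma' I J f g l -> spherical_normal J l n -> I u -> J v ->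
  orthonormal_frame (meridian_surface f g l) u v (0, / f u) (1, 0).
Proof.
  intros hM hn Hu Hv.
  destruct (meridian_first_form I J f g l n u v hM hn Hu Hv) as [H1 [H2 H3]].
  unfold orthonormal_frame, tangent; simpl fst; simpl snd.
  expand_inner. rewrite (inner_sym (Dv _ u v) (Du _ u v)), H1, H2, H3.
  pose proof (Ma_f_neq0 _ _ _ _ _ hM u Hu).
  repeat split; field; auto.
Qed.

(** Here [W = t' / f - f'' l - g'' e4], with [<W, z_v> = 0] and [<W, z_u> = - f' / f] because
    [f' f'' = g' g'']. The factor [f^2 (f'^2 + 1)] clears the denominators and allows [g''] to be
    eliminated. *)
Lemma meridian_mean_curvature (I J : R -> Prop) (f g : R -> R) (l n : R -> E4)
    (u v : R) (E1 E2 : R * R) :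
  meridian_Ma' I J f g l -> spherical_normal J l n -> I u -> J v ->
  orthonormal_frame (meridian_surface f g l) u v E1 E2 ->
  let H := mean_curvature_vector (meridian_surface f g l) u v E1 E2 in
  4 * f u ^ 2 * (Derive f u ^ 2 + 1) * inner H H =
  (f u * Derive (Derive f) u + Derive f u ^ 2 + 1) ^ 2
  - kappa l n v ^ 2 * (Derive f u ^ 2 + 1).
Proof.
  intros hM hn Hu Hv HE H.
  assert (El : in_E31 (l v)) by apply (Ma_sphere _ _ _ _ _ hM v Hv).
  assert (Hll : inner (l v) (l v) = 1) by apply (Ma_sphere _ _ _ _ _ hM v Hv).
  pose proof (Ma_f_neq0 _ _ _ _ _ hM u Hu) as Hf0.
  pose proof (Ma_meridian _ _ _ _ _ hM u Hu) as Hfg.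
  pose proof (meridian_derive_relation I J f g l hM u Hu) as Hfg'.
  pose proof (in_E31_Derive4 J l (proj1 (Ma_J _ _ _ _ _ hM)) (Ma_l _ _ _ _ _ hM)
    (fun s Hs => proj1 (Ma_sphere _ _ _ _ _ hM s Hs)) v Hv) as Et.
  destruct (spherical_curve_frame J l n v (proj1 (Ma_J _ _ _ _ _ hM))
    (Ma_l _ _ _ _ _ hM) (Ma_sphere _ _ _ _ _ hM) (Ma_unit _ _ _ _ _ hM) hn Hv)
    as [Et' [Hlt [Hlt' [Htt' Ht't']]]].
  destruct (meridian_first_form I J f g l n u v hM hn Hu Hv) as [F1 [F2 F3]].
  assert (HH := mean_curvature_frame (meridian_surface f g l) u v (f u) E1 E2
                  Hf0 F1 F2 F3 HE).
  cbv zeta in HH. fold H in HH.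
  rewrite Du_Du_meridian, Dv_Dv_meridian, Du_meridian, Dv_meridian in HH
    by assumption.
  revert HH. expand_inner.
  rewrite ?(inner_sym e4 (l v)), ?(inner_sym e4 (Derive4 l v)),
    ?(inner_sym e4 (Derive4 (Derive4 l) v)), ?(inner_sym (Derive4 l v) (l v)),
    ?(inner_sym (l v) (Derive4 (Derive4 l) v)),
    ?(inner_sym (Derive4 l v) (Derive4 (Derive4 l) v)).
  rewrite ?inner_e4_e4, ?(inner_e4 _ El), ?(inner_e4 _ Et), ?(inner_e4 _ Et').
  rewrite Hll, Hlt, Hlt', Htt', Ht't'.
  set (k := kappa l n v). set (f0 := f u) in *.
  set (f1 := Derive f u) in *. set (g1 := Derive g u) in *.
  set (f2 := Derive (Derive f) u) in *. set (g2 := Derive (Derive g) u) in *.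
  intros HH.
  replace (4 * f0 ^ 2 * (f1 ^ 2 + 1) * inner H H)
    with (f0 ^ 2 * (f1 ^ 2 + 1) * (4 * inner H H)) by ring.
  rewrite HH.
  (* Eliminates [g''] through [g'^2 = f'^2 + 1]. *)
  assert (G2 : (f1 ^ 2 + 1) * g2 ^ 2 = (f1 * f2) ^ 2).
  { rewrite Hfg'. replace (f1 ^ 2 + 1) with (g1 ^ 2) by lra. ring. }
  transitivity ((f1 ^ 2 + 1) * (f0 ^ 2 * f2 ^ 2 + 2 * f0 * f2 + 1 - k ^ 2
      + (f1 + f0 * (f1 * f2 - g1 * g2)) ^ 2)
    - f0 ^ 2 * ((f1 ^ 2 + 1) * g2 ^ 2)).
  - field; exact Hf0.
  - rewrite G2, <- Hfg'. ring.
Qed.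

(** * The primitive of sqrt (a^2 + 4 c t^2) *)

Lemma is_derive_asin (x : R) :
  -1 < x < 1 -> is_derive asin x (/ sqrt (1 - x ^ 2)).
Proof.
  intros Hx. apply is_derive_Reals.
  apply (derive_pt_eq_1 _ _ _ (derivable_pt_asin x Hx)).
  rewrite derive_pt_asin. unfold Rsqr, Rdiv.
  rewrite Rmult_1_l. do 3 f_equal. ring.
Qed.

Section Bracket.

Variables c a t : R.
Hypotheses (Ha : a <> 0) (Hpos : 0 < a ^ 2 + 4 * c * t ^ 2).

Let S := sqrt (a ^ 2 + 4 * c * t ^ 2).

Lemma root_gt0 : 0 < S.
Proof. apply sqrt_lt_R0, Hpos. Qed.

Lemma root_sqr : S ^ 2 = a ^ 2 + 4 * c * t ^ 2.
Proof. apply pow2_sqrt; lra. Qed.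

Lemma is_derive_root :
  is_derive (fun s => sqrt (a ^ 2 + 4 * c * s ^ 2)) t (4 * c * t / S).
Proof.
  auto_derive.
  - simpl in Hpos; lra.
  - change (a * (a * 1) + 4 * c * (t * (t * 1))) with (a ^ 2 + 4 * c * t ^ 2).
    fold S. pose proof root_gt0. field. lra.
Qed.

(** The product rule gives [S / 2 + 2 c t^2 / S], and [4 c t^2 = S^2 - a^2]. The defect
    [- a^2 / (2 S)] is what the logarithm or arcsine term has to compensate. *)
Lemma is_derive_half_t_root :
  is_derive (fun s => s / 2 * sqrt (a ^ 2 + 4 * c * s ^ 2)) t
    (S - a ^ 2 / (2 * S)).
Proof.
  pose proof root_gt0 as HS.
  evar_last.
  - apply @is_derive_mult; [| apply is_derive_root | exact Rmult_comm].
    apply (is_derive_ext (fun s => / 2 * s)); [intros; simpl; field|].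
    apply is_derive_scal, is_derive_id.
  - unfold plus, mult; cbn -[pow]; fold S. change one with 1.
    apply Rminus_diag_uniq.
    transitivity ((a ^ 2 + 4 * c * t ^ 2 - S ^ 2) / (2 * S)).
    + field; lra.
    + rewrite root_sqr. field; lra.
Qed.

Lemma is_derive_log_term :
  0 < c ->
  is_derive (fun s => a ^ 2 / (4 * sqrt c)
      * ln (Rabs (2 * sqrt c * s + sqrt (a ^ 2 + 4 * c * s ^ 2)))) t
    (a ^ 2 / (2 * S)).
Proof.
  intros Hc. pose proof root_gt0 as HS.
  pose proof (sqrt_lt_R0 c Hc) as Hk.
  assert (Hk2 : sqrt c ^ 2 = c) by (apply pow2_sqrt; lra).
  set (k := sqrt c) in *.
  assert (HL : forall s, 0 < 2 * k * s + sqrt (a ^ 2 + 4 * c * s ^ 2)).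
  { intros s.
    assert (L : Rabs (2 * k * s) < sqrt (a ^ 2 + 4 * c * s ^ 2)).
    { rewrite <- sqrt_Rsqr_abs. apply sqrt_lt_1.
      - apply Rle_0_sqr.
      - nra.
      - unfold Rsqr. rewrite <- Hk2.
        assert (0 < a ^ 2) by now apply pow2_gt_0. nra. }
    apply Rabs_def2 in L. lra. }
  apply (is_derive_ext (fun s => a ^ 2 / (4 * k)
      * ln (2 * k * s + sqrt (a ^ 2 + 4 * c * s ^ 2)))).
  { intros s. rewrite (Rabs_pos_eq (2 * k * s + _)); [reflexivity|].
    now apply Rlt_le. }
  evar_last.
  - apply is_derive_scal.
    apply (is_derive_comp ln
             (fun s => 2 * k * s + sqrt (a ^ 2 + 4 * c * s ^ 2))).
    + apply is_derive_ln, HL.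
    + apply @is_derive_plus; [|apply is_derive_root].
      apply is_derive_scal, is_derive_id.
  - unfold plus, scal; cbn -[pow]; unfold mult; cbn -[pow]. change one with 1.
    fold S. specialize (HL t). fold S in HL. rewrite <- Hk2.
    field. repeat split; lra.
Qed.

(** With [x = 2 k t / a], [k = sqrt (- c)], one has [sqrt (1 - x^2) = S / |a|], while the inner
    derivative is [2 k / a]. The surviving sign of [a] is the reason for the case split in
    [tied_signs]. *)
Lemma is_derive_arcsin_term :
  c < 0 ->
  is_derive (fun s => a ^ 2 / (4 * sqrt (- c))
      * asin (2 * sqrt (- c) * s / a)) t
    (a * Rabs a / (2 * S)).
Proof.
  intros Hc. pose proof root_gt0 as HS. pose proof root_sqr as HS2.
  assert (Hk : 0 < sqrt (- c)) by (apply sqrt_lt_R0; lra).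
  assert (Hk2 : sqrt (- c) ^ 2 = - c) by (apply pow2_sqrt; lra).
  set (k := sqrt (- c)) in *.
  assert (HA : 0 < Rabs a) by now apply Rabs_pos_lt.
  assert (HA2 : Rabs a ^ 2 = a ^ 2) by apply pow2_abs.
  assert (Hroot : sqrt (1 - (2 * k * t / a) ^ 2) = S / Rabs a).
  { replace (1 - (2 * k * t / a) ^ 2) with ((S / Rabs a) ^ 2).
    - apply sqrt_pow2. apply Rlt_le, Rdiv_lt_0_compat; lra.
    - transitivity (S ^ 2 / Rabs a ^ 2); [field; lra|]. rewrite HA2, HS2.
      replace c with (- k ^ 2) by lra. field. exact Ha. }
  (* [sqrt] is 0 on nonpositive reals, so the positive value just found forces [x^2 < 1]. *)
  assert (Hx : -1 < 2 * k * t / a < 1).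
  { assert (P : 0 < sqrt (1 - (2 * k * t / a) ^ 2)).
    { rewrite Hroot. apply Rdiv_lt_0_compat; lra. }
    assert (P1 : 0 < 1 - (2 * k * t / a) ^ 2).
    { apply Rnot_le_lt; intros N. apply sqrt_neg_0 in N. lra. }
    split; nra. }
  evar_last.
  - apply is_derive_scal.
    apply (is_derive_comp asin (fun s => 2 * k * s / a)).
    + apply is_derive_asin, Hx.
    + apply (is_derive_ext (fun s => 2 * k / a * s)); [intros; simpl; field; exact Ha|].
      apply is_derive_scal, is_derive_id.
  - unfold scal; cbn -[pow]; unfold mult; cbn -[pow]. change one with 1.
    rewrite Hroot. field. repeat split; lra.
Qed.

(** The tied signs are exactly those for which the terms in [1 / S] cancel. *)
Lemma is_derive_bracket (b s2 s3 : R) :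
  c <> 0 -> tied_signs c a s2 s3 -> is_derive (bracket c a b s2 s3) t (s2 * S).
Proof.
  intros Hc0 [_ [_ [Tc [Ta1 Ta2]]]]. pose proof root_gt0 as HS.
  pose proof is_derive_half_t_root as H1.
  unfold bracket. destruct (Rlt_dec 0 c) as [Hc | Hc].
  - pose proof (is_derive_log_term Hc) as H2.
    evar_last.
    + apply @is_derive_plus; [apply @is_derive_plus|].
      * apply is_derive_const.
      * apply is_derive_scal, H1.
      * apply is_derive_scal, H2.
    + unfold plus, zero; cbn -[pow]. rewrite (Tc Hc). field; lra.
  - assert (Hc' : c < 0) by lra.
    pose proof (is_derive_arcsin_term Hc') as H2.
    evar_last.
    + apply @is_derive_plus; [apply @is_derive_plus|].
      * apply is_derive_const.
      * apply is_derive_scal, H1.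
      * apply is_derive_scal, H2.
    + unfold plus, zero; cbn -[pow].
      destruct (Rtotal_order a 0) as [L | [L | L]]; [| contradiction |].
      * rewrite (Ta2 Hc' L), Rabs_left by exact L. field; lra.
      * rewrite (Ta1 Hc' L), Rabs_right by lra. field; lra.
Qed.

End Bracket.

Lemma tied_signs_exist (c a s2 : R) :
  c <> 0 -> a <> 0 -> is_sign s2 -> exists s3, tied_signs c a s2 s3.
Proof.
  intros Hc Ha Hs.
  assert (Hs' : is_sign (- s2)).
  { destruct Hs as [-> | ->]; [right | left]; lra. }
  destruct (Rlt_dec 0 c) as [H | H]; [|destruct (Rlt_dec 0 a) as [H' | H']];
    [exists s2 | exists s2 | exists (- s2)];
    repeat split; auto; intros; lra.
Qed.

(** * The ordinary differential equation of the meridian *)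

(** For [a] the curvature of [l] at [v], this is [4 f^2 (f'^2 + 1) (<H,H> - c)] on the meridian
    surface. *)
Definition cmc_defect (f : R -> R) (c a u : R) : R :=
  (f u * Derive (Derive f) u + Derive f u ^ 2 + 1) ^ 2
  - (Derive f u ^ 2 + 1) * (a ^ 2 + 4 * c * f u ^ 2).

Lemma is_derive_bracket_comp (f : R -> R) (c a b s2 s3 u : R) :
  c <> 0 -> a <> 0 -> tied_signs c a s2 s3 -> ex_derive f u ->
  0 < a ^ 2 + 4 * c * f u ^ 2 ->
  is_derive (fun s => bracket c a b s2 s3 (f s)) u
    (Derive f u * (s2 * sqrt (a ^ 2 + 4 * c * f u ^ 2))).
Proof.
  intros Hc Ha HT Hf Hpos.
  apply (is_derive_comp (bracket c a b s2 s3) f).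
  - now apply is_derive_bracket.
  - now apply Derive_correct.
Qed.

Lemma bracket_const (c a b s2 s3 t : R) :
  bracket c a b s2 s3 t = b + bracket c a 0 s2 s3 t.
Proof. unfold bracket; destruct (Rlt_dec 0 c); ring. Qed.

(** The radicand of [phi] becomes [(t p)^2], so the outer sign is that of [t p]. *)
Lemma phi_of_bracket (c a b s2 s3 t p : R) :
  t <> 0 -> bracket c a b s2 s3 t ^ 2 = t ^ 2 * (p ^ 2 + 1) ->
  exists s1, is_sign s1 /\ p = phi c a b s1 s2 s3 t.
Proof.
  intros Ht HB. unfold phi. rewrite HB.
  replace (t ^ 2 * (p ^ 2 + 1) - t ^ 2) with (Rsqr (t * p)) by (unfold Rsqr; ring).
  rewrite sqrt_Rsqr_abs.
  destruct (Rle_dec 0 (t * p)) as [L | L].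
  - exists 1. split; [now left|]. rewrite Rabs_pos_eq by exact L. field; exact Ht.
  - exists (-1). split; [now right|]. rewrite Rabs_left by lra. field; exact Ht.
Qed.

Lemma bracket_of_phi (c a b s1 s2 s3 t : R) :
  is_sign s1 -> phi_dom c a b s2 s3 t ->
  bracket c a b s2 s3 t ^ 2 = t ^ 2 * (phi c a b s1 s2 s3 t ^ 2 + 1).
Proof.
  intros Hs [Ht [_ Hd]]. unfold phi.
  set (r := sqrt (bracket c a b s2 s3 t ^ 2 - t ^ 2)).
  assert (Hr : r ^ 2 = bracket c a b s2 s3 t ^ 2 - t ^ 2) by now apply pow2_sqrt.
  transitivity (s1 ^ 2 * r ^ 2 + t ^ 2); [|field; exact Ht].
  rewrite Hr. destruct Hs as [-> | ->]; ring.
Qed.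

Lemma determined_of_defect0 (I J : R -> Prop) (f g : R -> R) (l : R -> E4)
    (c a : R) :
  meridian_Ma' I J f g l -> c <> 0 -> a <> 0 ->
  (forall u, I u -> cmc_defect f c a u = 0) ->
  determined_by_phi I f c a.
Proof.
  intros hM Hc Ha H0. unfold cmc_defect in H0.
  assert (HI := Ma_I _ _ _ _ _ hM).
  assert (Hg := Ma_g _ _ _ _ _ hM).
  assert (Hf := Ma_f _ _ _ _ _ hM).
  assert (Hf1 := smooth_on_Derive I f Hf).
  assert (Hf2 := smooth_on_Derive I _ Hf1).
  assert (Hg1 := smooth_on_Derive I g Hg).
  assert (Hg0 : forall u, I u -> Derive g u <> 0).
  { intros u Hu. apply Rgt_not_eq, (Ma_g_incr _ _ _ _ _ hM u Hu). }
  assert (Hfg : forall u, I u -> Derive f u ^ 2 + 1 = Derive g u ^ 2).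
  { intros u Hu. assert (M := Ma_meridian _ _ _ _ _ hM u Hu). lra. }
  (* [(f f'' + f'^2 + 1) / g'], with [f'^2 + 1 = g'^2] already divided out. *)
  set (E := fun u => Derive g u + f u * Derive (Derive f) u / Derive g u).
  assert (HE : forall u, I u -> E u ^ 2 = a ^ 2 + 4 * c * f u ^ 2).
  { intros u Hu. specialize (H0 u Hu).
    transitivity ((f u * Derive (Derive f) u + Derive g u ^ 2) ^ 2
                  / Derive g u ^ 2).
    - unfold E; field; auto.
    - rewrite <- (Hfg u Hu).
      replace ((f u * Derive (Derive f) u + (Derive f u ^ 2 + 1)) ^ 2)
        with ((f u * Derive (Derive f) u + Derive f u ^ 2 + 1) ^ 2) by ring.
      apply Rminus_diag_uniq in H0; rewrite H0. field.
      rewrite (Hfg u Hu); now apply pow_nonzero, Hg0. }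
  split.
  { intros u Hu. rewrite <- HE by exact Hu. apply pow2_ge_0. }
  intros K HK HKI Hpos.
  set (root := fun u => sqrt (a ^ 2 + 4 * c * f u ^ 2)).
  assert (Hroot : forall u, K u -> 0 < root u).
  { intros u Hu; apply sqrt_lt_R0; auto. }
  assert (Hroot2 : forall u, K u -> root u ^ 2 = a ^ 2 + 4 * c * f u ^ 2).
  { intros u Hu. apply pow2_sqrt, Rlt_le; auto. }
  destruct (proj1 (proj2 HK)) as [u0 Hu0].
  (* The ratio is differentiable with square 1, hence a constant sign; it becomes [s2]. *)
  assert (Hsig : forall u, K u -> E u / root u = E u0 / root u0).
  { intros u Hu.
    apply (square_const_const K (fun s => E s / root s) 1); auto.
    - intros s Hs.
      assert (D1 : ex_derive f s) by apply (Hf 1%nat s (HKI s Hs)).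
      assert (D2 : ex_derive (Derive (Derive f)) s)
        by apply (Hf2 1%nat s (HKI s Hs)).
      assert (D3 : ex_derive (Derive g) s) by apply (Hg1 1%nat s (HKI s Hs)).
      apply @ex_derive_div; [| |now apply Rgt_not_eq, Hroot].
      + apply @ex_derive_plus; [exact D3|].
        apply @ex_derive_div; [now apply @ex_derive_mult|exact D3|auto].
      + apply (ex_derive_comp (fun t => sqrt (a ^ 2 + 4 * c * t ^ 2)) f);
          [|exact D1].
        eexists; apply is_derive_root; auto.
    - intros s Hs. specialize (Hroot s Hs).
      transitivity (E s ^ 2 / root s ^ 2); [field; lra|].
      rewrite HE, <- Hroot2 by auto. field; lra. }
  set (s2 := E u0 / root u0) in *.
  assert (Hs2 : is_sign s2).
  { assert (Q : s2 ^ 2 = 1).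
    { specialize (Hroot u0 Hu0). unfold s2.
      transitivity (E u0 ^ 2 / root u0 ^ 2); [field; lra|].
      rewrite HE, <- Hroot2 by auto. field; lra. }
    assert (Q' : (s2 - 1) * (s2 + 1) = 0) by lra.
    apply Rmult_integral in Q' as [Q' | Q']; [left | right]; lra. }
  destruct (tied_signs_exist c a s2 Hc Ha Hs2) as [s3 HT].
  set (B := fun u => bracket c a 0 s2 s3 (f u)).
  assert (HD : forall u, K u -> is_derive (fun s => f s * Derive g s - B s) u 0).
  { intros u Hu. assert (Iu := HKI u Hu).
    evar_last.
    - apply @is_derive_minus.
      + apply @is_derive_mult; [| |exact Rmult_comm].
        * apply (smooth_on_is_derive I f u Hf Iu).
        * apply (smooth_on_is_derive I _ u Hg1 Iu).
      + apply is_derive_bracket_comp; auto. apply (Hf 1%nat u Iu).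
    - assert (R1 := meridian_derive_relation I J f g l hM u Iu).
      fold (root u). specialize (Hsig u Hu). specialize (Hroot u Hu).
      assert (HEr : s2 * root u = E u) by (rewrite <- Hsig; field; lra).
      rewrite HEr. unfold E, minus, plus, opp, mult; cbn -[pow].
      (* The terms [f' g'] cancel between [(f g')'] and [f' E]; the rest vanishes by
         [f' f'' = g' g'']. *)
      transitivity (f u * (Derive g u * Derive (Derive g) u
        - Derive f u * Derive (Derive f) u) / Derive g u).
      + field; auto.
      + rewrite R1. field; auto. }
  (* [b] is the constant value of [f g' - B], where [B] is the bracket with zero constant term. *)
  exists (f u0 * Derive g u0 - B u0), s2, s3.
  split; [exact HT|].
  intros u Hu. assert (Iu := HKI u Hu).
  assert (HB : bracket c a (f u0 * Derive g u0 - B u0) s2 s3 (f u)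
               = f u * Derive g u).
  { rewrite bracket_const. fold (B u).
    assert (C := derive_zero_const K _ HK HD u0 u Hu0 Hu). simpl in C. lra. }
  assert (HB2 : bracket c a (f u0 * Derive g u0 - B u0) s2 s3 (f u) ^ 2
                = f u ^ 2 * (Derive f u ^ 2 + 1)).
  { rewrite HB, (Hfg u Iu). ring. }
  assert (Hfu := Ma_f_neq0 _ _ _ _ _ hM u Iu).
  split.
  - split; [exact Hfu|]. split; [now apply Rlt_le, Hpos|].
    rewrite HB2.
    replace (f u ^ 2 * (Derive f u ^ 2 + 1) - f u ^ 2)
      with ((f u * Derive f u) ^ 2) by ring.
    apply pow2_ge_0.
  - now apply phi_of_bracket.
Qed.

(** * From the first-order equation back to the second-order one *)

Lemma derive_zero_minimum (K : R -> Prop) (h : R -> R) (u d : R) :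
  open K -> K u -> is_derive h u d ->
  (forall s, K s -> h u <= h s) -> d = 0.
Proof.
  intros HK Hu Hd Hmin.
  destruct (HK u Hu) as [e He].
  assert (pr : derivable_pt h u) by (apply ex_derive_Reals_0; now exists d).
  rewrite <- (is_derive_unique _ _ _ Hd), <- (Derive_Reals h u pr).
  pose proof (cond_pos e).
  apply (deriv_minimum h (u - e) (u + e) u pr); try lra.
  intros s Hs1 Hs2. apply Hmin, He. apply Rabs_def1; simpl;
    unfold minus, plus, opp; simpl; lra.
Qed.

Lemma open_continuous_pos (K : R -> Prop) (h : R -> R) (u : R) :
  open K -> K u -> continuous h u -> 0 < h u ->
  exists d : posreal, forall s, Rabs (s - u) < d -> K s /\ 0 < h s.
Proof.
  intros HK Hu Hh Hp.
  assert (L : locally u (fun s => K s /\ 0 < h s)).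
  { apply filter_and; [now apply HK|].
    apply (Hh (fun y => 0 < y)), open_gt, Hp. }
  exact L.
Qed.

(** The factor [f'] absorbs the critical points. Near any other point the radicand is positive, so
    one choice of constants is valid on a whole neighbourhood and the squared first-order equation
    can be differentiated there. *)
Lemma defect_of_determined (I : R -> Prop) (f : R -> R) (c a u : R) :
  open I -> smooth_on I f -> (forall s, I s -> f s <> 0) ->
  c <> 0 -> a <> 0 -> determined_by_phi I f c a -> I u ->
  Derive f u * cmc_defect f c a u = 0.
Proof.
  intros HI Hf Hf0 Hc Ha [Hge Hdet] Hu.
  assert (Hf1 := smooth_on_Derive I f Hf).
  destruct (Req_dec (Derive f u) 0) as [Z | Z]; [rewrite Z; ring|].
  assert (Df : forall s, I s -> is_derive f s (Derive f s)).
  { intros s Hs. now apply (smooth_on_is_derive I f s). }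
  assert (DR : forall s, I s -> is_derive (fun s => a ^ 2 + 4 * c * f s ^ 2) s
                 (8 * c * f s * Derive f s)).
  { intros s Hs. evar_last.
    - apply @is_derive_plus; [apply is_derive_const|].
      apply is_derive_scal, is_derive_square, Df, Hs.
    - unfold plus, zero; cbn -[pow]; ring. }
  (* A zero of the radicand is a minimum, hence a critical point of f. *)
  assert (Hpos : 0 < a ^ 2 + 4 * c * f u ^ 2).
  { destruct (Hge u Hu) as [L | E]; [exact L | exfalso].
    assert (Q := derive_zero_minimum I _ u _ HI Hu (DR u Hu)).
    cbv beta in Q. rewrite <- E in Q. specialize (Q Hge).
    apply Rmult_integral in Q as [Q | Q]; [|contradiction].
    apply Rmult_integral in Q as [Q | Q]; [lra | now apply (Hf0 u)]. }
  destruct (open_continuous_pos I (fun s => a ^ 2 + 4 * c * f s ^ 2) u)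
    as [d Hd]; auto.
  { apply (ex_derive_continuous (fun s => a ^ 2 + 4 * c * f s ^ 2)).
    eexists; apply DR, Hu. }
  set (K := fun s => Rabs (s - u) < d).
  assert (Ku : K u).
  { unfold K; rewrite Rminus_diag_eq, Rabs_R0 by reflexivity. apply cond_pos. }
  assert (HK : Defs.open_interval K).
  { split; [|split; [now exists u|]].
    - apply (open_ext (fun s => u - d < s /\ s < u + d)).
      + intros s; unfold K; split.
        * intros [? ?]; apply Rabs_def1; lra.
        * intros L; apply Rabs_def2 in L; lra.
      + apply open_and; [apply open_gt | apply open_lt].
    - unfold K; intros x y w Hx Hy Hw.
      apply Rabs_def2 in Hx, Hy. apply Rabs_def1; lra. }
  destruct (Hdet K HK (fun s Hs => proj1 (Hd s Hs)) (fun s Hs => proj2 (Hd s Hs)))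
    as [b [s2 [s3 [HT Hsol]]]].
  (* Squaring removes the outer sign [s1], which may vary with the point. *)
  assert (HB : forall s, K s -> bracket c a b s2 s3 (f s) ^ 2
                 - f s ^ 2 * (Derive f s ^ 2 + 1) = 0).
  { intros s Hs. destruct (Hsol s Hs) as [Hdom [s1 [Hs1 ->]]].
    rewrite (bracket_of_phi c a b s1 s2 s3 (f s) Hs1 Hdom). ring. }
  set (f0 := f u). set (f1 := Derive f u) in *.
  set (f2 := Derive (Derive f) u).
  set (r := sqrt (a ^ 2 + 4 * c * f0 ^ 2)).
  assert (HE : 2 * bracket c a b s2 s3 f0 * (f1 * (s2 * r))
    - (2 * f0 * f1 * (f1 ^ 2 + 1) + f0 ^ 2 * (2 * f1 * f2)) = 0).
  { apply (is_derive_const_on K _ 0 u _ (proj1 HK) HB Ku).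
    apply @is_derive_minus.
    - apply (is_derive_square (fun s => bracket c a b s2 s3 (f s))).
      apply is_derive_bracket_comp; auto.
      eexists; apply Df, Hu.
    - evar_last.
      + apply @is_derive_mult; [| |exact Rmult_comm].
        * apply is_derive_square, Df, Hu.
        * apply @is_derive_plus; [|apply is_derive_const].
          apply is_derive_square, (smooth_on_is_derive I _ u Hf1 Hu).
      + unfold plus, mult, zero; cbn -[pow]. unfold f0, f1, f2; ring. }
  specialize (HB u Ku). fold f0 f1 in HB.
  set (B := bracket c a b s2 s3 f0) in *.
  assert (Hr : r ^ 2 = a ^ 2 + 4 * c * f0 ^ 2) by now apply pow2_sqrt, Rlt_le.
  assert (Hs : s2 ^ 2 = 1).
  { destruct HT as [[-> | ->] _]; ring. }
  assert (HE' : B * (s2 * r) = f0 * (f0 * f2 + f1 ^ 2 + 1)).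
  { apply Rmult_eq_reg_l with (2 * f1); lra. }
  assert (F0 : f0 <> 0) by now apply Hf0.
  unfold cmc_defect. fold f0 f1 f2.
  (* Squaring [HE'] eliminates [s2], and [HB] then replaces [B^2]. *)
  assert (HG : f0 ^ 2 * ((f0 * f2 + f1 ^ 2 + 1) ^ 2
                 - (f1 ^ 2 + 1) * (a ^ 2 + 4 * c * f0 ^ 2)) = 0).
  { transitivity ((f0 * (f0 * f2 + f1 ^ 2 + 1)) ^ 2
                  - (f0 ^ 2 * (f1 ^ 2 + 1)) * r ^ 2); [rewrite Hr; ring|].
    rewrite <- HE'. replace (f0 ^ 2 * (f1 ^ 2 + 1)) with (B ^ 2) by lra.
    replace ((B * (s2 * r)) ^ 2) with (B ^ 2 * s2 ^ 2 * r ^ 2) by ring.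
    rewrite Hs; ring. }
  apply Rmult_integral in HG as [HG | ->]; [|ring].
  exfalso; now apply (pow_nonzero f0 2 F0).
Qed.

(* If [f' G = 0] for the defect [G], then [f'], [f''], [f'''] and hence [G']
   vanish wherever [G] does not, so [G^2] is constant. This excludes a smooth
   solution that leaves a constant piece of [f] on which the equation fails. *)
Lemma defect_eq0_of_mul (I : R -> Prop) (f : R -> R) (c a : R) :
  Defs.open_interval I -> smooth_on I f ->
  (exists u1 u2, I u1 /\ I u2 /\ f u1 <> f u2) ->
  (forall u, I u -> Derive f u * cmc_defect f c a u = 0) ->
  forall u, I u -> cmc_defect f c a u = 0.
Proof.
  intros HI Hf [u1 [u2 [I1 [I2 Hne]]]] H1.
  assert (Hf1 := smooth_on_Derive I f Hf).
  assert (Hf2 := smooth_on_Derive I _ Hf1).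
  assert (D0 : forall s, I s -> is_derive f s (Derive f s))
    by (intros s; apply smooth_on_is_derive, Hf).
  assert (D1 : forall s, I s -> is_derive (Derive f) s (Derive (Derive f) s))
    by (intros s; apply smooth_on_is_derive, Hf1).
  assert (D2 : forall s, I s -> is_derive (Derive (Derive f)) s
                                  (Derive (Derive (Derive f)) s))
    by (intros s; apply smooth_on_is_derive, Hf2).
  set (f1 := Derive f) in *. set (f2 := Derive f1) in *.
  set (f3 := Derive f2) in *.
  set (G := cmc_defect f c a) in *.
  set (G' := fun s =>
    2 * (f s * f2 s + f1 s ^ 2 + 1) * (3 * f1 s * f2 s + f s * f3 s)
    - (2 * f1 s * f2 s * (a ^ 2 + 4 * c * f s ^ 2)
       + (f1 s ^ 2 + 1) * (8 * c * f s * f1 s))).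
  assert (DG : forall s, I s -> is_derive G s (G' s)).
  { intros s Is. unfold G, cmc_defect. fold f1 f2. evar_last.
    - apply @is_derive_minus.
      + apply (is_derive_square (fun s => f s * f2 s + f1 s ^ 2 + 1)).
        apply @is_derive_plus; [apply @is_derive_plus|apply is_derive_const].
        * apply @is_derive_mult; [apply D0, Is | apply D2, Is | exact Rmult_comm].
        * apply is_derive_square, D1, Is.
      + apply @is_derive_mult; [| |exact Rmult_comm].
        * apply @is_derive_plus; [|apply is_derive_const].
          apply is_derive_square, D1, Is.
        * apply @is_derive_plus; [apply is_derive_const|].
          apply is_derive_scal, is_derive_square, D0, Is.
    - unfold G', minus, plus, opp, mult, zero; cbn -[pow]. ring. }
  (* Differentiating [f' G = 0] gives [f'' G + f' G' = 0], and [f' = 0] wherever [G <> 0]. The next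
     step repeats this with [f'']. *)
  assert (H2 : forall s, I s -> f2 s * G s = 0).
  { intros s Is.
    assert (E : f2 s * G s + f1 s * G' s = 0).
    { apply (is_derive_const_on I _ 0 s _ (proj1 HI) H1 Is).
      apply @is_derive_mult; auto using Rmult_comm. }
    destruct (Req_dec (G s) 0) as [Z | Z]; [rewrite Z; ring|].
    destruct (Rmult_integral _ _ (H1 s Is)) as [Q | Q]; [|contradiction].
    rewrite Q in E. lra. }
  assert (H3 : forall s, I s -> G s * G' s = 0).
  { intros s Is.
    assert (E : f3 s * G s + f2 s * G' s = 0).
    { apply (is_derive_const_on I _ 0 s _ (proj1 HI) H2 Is).
      apply @is_derive_mult; auto using Rmult_comm. }
    destruct (Req_dec (G s) 0) as [Z | Z]; [rewrite Z; ring|].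
    destruct (Rmult_integral _ _ (H1 s Is)) as [Q1 | Q1]; [|contradiction].
    destruct (Rmult_integral _ _ (H2 s Is)) as [Q2 | Q2]; [|contradiction].
    rewrite Q2 in E.
    destruct (Rmult_integral (f3 s) (G s)) as [Q3 | Q3];
      [lra | | contradiction].
    unfold G'. rewrite Q1, Q2, Q3. ring. }
  assert (HG : forall s t, I s -> I t -> G s ^ 2 = G t ^ 2).
  { apply (derive_zero_const I (fun s => G s ^ 2) HI).
    intros s Is. evar_last; [apply is_derive_square, DG, Is|].
    specialize (H3 s Is). lra. }
  (* If [G] is nonzero at [u], constancy of [G^2] makes it nonzero on all of [I]; then [f' = 0]
     there, contradicting that [f] is not constant. *)
  intros u Iu. destruct (Req_dec (G u) 0) as [Z | Z]; [exact Z | exfalso].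
  apply Hne, (derive_zero_const I f HI); auto.
  intros s Is.
  destruct (Rmult_integral _ _ (H1 s Is)) as [Q | Q].
  - rewrite <- Q. now apply D0.
  - exfalso. apply (pow_nonzero (G u) 2 Z).
    rewrite (HG u s Iu Is), Q. ring.
Qed.

(** * The equivalence for the surface *)

Lemma cmc_iff_defect0 (I J : R -> Prop) (f g : R -> R) (l n : R -> E4) (c : R) :
  meridian_Ma' I J f g l -> spherical_normal J l n ->
  constant_mean_curvature I J (meridian_surface f g l) c <->
  forall u v, I u -> J v -> cmc_defect f c (kappa l n v) u = 0.
Proof.
  intros hM hn.
  assert (HH : forall u v, I u -> J v -> forall E1 E2,
    orthonormal_frame (meridian_surface f g l) u v E1 E2 ->
    let H := mean_curvature_vector (meridian_surface f g l) u v E1 E2 in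
    4 * f u ^ 2 * (Derive f u ^ 2 + 1) * (inner H H - c)
    = cmc_defect f c (kappa l n v) u).
  { intros u v Hu Hv E1 E2 HE H.
    rewrite Rmult_minus_distr_l. unfold H.
    rewrite (meridian_mean_curvature I J f g l n) by assumption.
    unfold cmc_defect; ring. }
  split.
  - intros HC u v Hu Hv.
    assert (HE := orthonormal_frame_meridian I J f g l n u v hM hn Hu Hv).
    rewrite <- (HH u v Hu Hv _ _ HE), (HC u v Hu Hv _ _ HE). ring.
  - intros H0 u v Hu Hv E1 E2 HE.
    assert (Q := HH u v Hu Hv _ _ HE). cbv zeta in Q.
    rewrite (H0 u v Hu Hv) in Q.
    assert (0 < f u ^ 2) by (apply pow2_gt_0, (Ma_f_neq0 _ _ _ _ _ hM u Hu)).
    pose proof (pow2_ge_0 (Derive f u)).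
    apply Rmult_integral in Q as [Q | Q]; [nra | lra].
Qed.

Lemma ex_derive_kappa (J : R -> Prop) (l n : R -> E4) (v : R) :
  smooth4_on J l -> smooth4_on J n -> J v -> ex_derive (kappa l n) v.
Proof.
  intros Hl Hn Hv.
  eexists. apply (is_derive_inner J); auto using smooth4_on_Derive4.
Qed.

Theorem theorem8 (I J : R -> Prop) (f g : R -> R) (l n : R -> E4) (c : R)
    (hM : meridian_Ma' I J f g l)
    (hn : spherical_normal J l n)
    (hkappa : exists v, J v /\ kappa l n v <> 0)
    (hf : exists u1 u2, I u1 /\ I u2 /\ f u1 <> f u2)
    (hc : c <> 0) :
  constant_mean_curvature I J (meridian_surface f g l) c
  <->
  exists a : R,
    a <> 0 /\
    (forall v, J v -> kappa l n v = a) /\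
    determined_by_phi I f c a /\
    (forall u, I u -> Derive g u = sqrt (Derive f u ^ 2 + 1)).
Proof.
  rewrite (cmc_iff_defect0 I J f g l n c hM hn).
  pose proof (Ma_I _ _ _ _ _ hM) as HI.
  pose proof (Ma_f _ _ _ _ _ hM) as Hf.
  split.
  - intros H0. destruct hkappa as [v0 [Hv0 Ha]].
    exists (kappa l n v0). split; [exact Ha|]. split; [|split].
    + destruct (proj1 (proj2 HI)) as [u0 Hu0].
      (* At a fixed [u0], the equations for [v] and [v0] differ only by the curvature term, whose
         coefficient [f'^2 + 1] is positive. *)
      assert (Hsq : forall v, J v -> kappa l n v ^ 2 = kappa l n v0 ^ 2).
      { intros v Hv.
        assert (Q := H0 u0 v Hu0 Hv). assert (Q0 := H0 u0 v0 Hu0 Hv0).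
        unfold cmc_defect in Q, Q0.
        pose proof (pow2_ge_0 (Derive f u0)).
        apply Rmult_eq_reg_l with (Derive f u0 ^ 2 + 1); lra. }
      intros v Hv.
      apply (square_const_const J _ (kappa l n v0 ^ 2));
        try apply (Ma_J _ _ _ _ _ hM); auto.
      intros s Hs.
      apply (ex_derive_kappa J); auto.
      * apply (Ma_l _ _ _ _ _ hM).
      * apply (sn_smooth _ _ _ hn).
    + apply (determined_of_defect0 I J f g l); auto.
    + intros u Hu.
      pose proof (Ma_meridian _ _ _ _ _ hM u Hu) as Hfg.
      pose proof (Ma_g_incr _ _ _ _ _ hM u Hu) as Hg.
      replace (Derive f u ^ 2 + 1) with (Derive g u ^ 2) by lra.
      symmetry; apply sqrt_pow2; lra.
  - intros [a [Ha [Hk [Hdet _]]]] u v Hu Hv.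
    rewrite (Hk v Hv).
    (* The factor [f'] is removed here by means of [hf]: [f] takes two distinct values. *)
    apply (defect_eq0_of_mul I); auto.
    intros s Hs.
    apply (defect_of_determined I); auto.
    + apply HI.
    + apply (Ma_f_neq0 _ _ _ _ _ hM).
Qed.
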